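(* Let $n\ge0$ and let $\sigma,\tau\in\mathrm{Typ}(n)$ be types of $n$. The coefficient of $E^+_\tau$ in the expansion of $P_\sigma$ in the basis $\{E^+_\rho:\rho\in\mathrm{Typ}(n)\}$ is $$\sum_{T\in \mathcal{PT}^{\mathrm{dyad}}_{\mathrm{sing}}(\sigma, \tau)} (-1)^{\ell(\tau)-\ell(\sigma)}\, \mathfrak{L}^*(T).$$
   Context: A type of $n$ is a sequence $\tau=(\tau|^1,\tau|^2,\dots)$ of (possibly empty) integer partitions with $\sum_{i\ge1} i\,|\tau|^i|=n$, where $|\tau|^i|$ is the size of the partition $\tau|^i$; $\mathrm{Typ}(n)$ is the set of types of $n$. Its length is $\ell(\tau)=\sum_i\ell(\tau|^i)$. Each part $d$ of $\tau|^r$ gives a block $d^r$ of $\tau$ (degree $d$, multiplicity $r$; not exponentiation); a type is thus a multiset of blocks. Let $x_{i,j}$ ($i,j\ge 1$) be indeterminates with $\deg x_{i,j}=i$; all series have rational coefficients. A monomial is square-free if every exponent is at most $1$. $E^+_d$ is the sum of all square-free monomials of degree $d$; for $d\ge1$, $P_d=\sum_{k\mid d}\sum_{j\ge1}k\,x_{k,j}^{d/k}$. For $F\in\{P,E^+\}$, $F_{d^r}$ is obtained from $F_d$ by replacing each $x_{i,j}$ by $x_{i,j}^r$, and $F_\tau=\prod F_{d^r}$ over all blocks $d^r$ of $\tau$ (counted with repetition; empty product $=1$). It is known that $\{F_\tau\}_{\tau\in\mathrm{Typ}(n)}$ is, for each such $F$, a $\mathbb{Q}$-basis of the space $\mathrm{PSym}(n)$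 of polysymmetric functions of degree $n$ (power series homogeneous of degree $n$ that are symmetric separately in each variable set $\{x_{i,j}\}_{j\ge1}$). The diagram of a partition $\lambda$ has left-justified rows of $\lambda_1,\lambda_2,\dots$ cells; the tensor diagram of $\sigma$ is the sequence of diagrams of $\sigma|^1,\sigma|^2,\dots$, the $i$th one being called the $i$th tensor factor. A brick is a nonempty set of consecutive cells in one row; its length is its number of cells. For $k\ge0$, a $k$-brick is a brick whose length is a multiple of $2^k$, carrying the marking $k$. A dyadic polybrick tabloid of shape $\sigma$ and content $\tau$ is a decomposition of the tensor diagram of $\sigma$ into disjoint $k$-bricks (for various $k\ge0$, the markings being part of the data) such that, in each row, whenever $k'>k$ every $k'$-brick appears to the right of every $k$-brick, and such that $\tau$ is the multiset of blocks obtained by taking a block $b^{2^k m}$ for each $k$-brick of length $2^k b$ in the $m$th tensor factor. It is called singular if, in each row, all the bricks are $k$-bricks for the same $k$ (which may depend on the row). $\mathcal{PT}^{\mathrm{dyad}}_{\mathrm{sing}}(\sigma,\tau)$ is the set of singular dyadic polybrick tabloids of shape $\sigma$ and content $\tau$. For such $T$, $\mathfrak{L}^*(T)$ is the product, over all rows of all tensor factors, of the length (number of cells) of the last (rightmost) brick in the row. *)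

(* Defs.v *)
From HB Require Import structures.
From mathcomp Require Import all_boot all_order all_algebra.
From mathcomp Require Import finmap monalg.
From mathcomp Require Import boolp classical_sets fsbigop.

Set Implicit Arguments.
Unset Strict Implicit.
Unset Printing Implicit Defensive.

Import GRing.Theory.

Local Open Scope classical_set_scope.
Local Open Scope ring_scope.

Record pnat := PNat { pval :> nat; _ : (0 < pval)%N }.
HB.instance Definition _ := [isSub for pval].
HB.instance Definition _ := [Choice of pnat by <:].

Definition is_partition (p : seq nat) : bool :=
  sorted geq p && all (fun d => 0 < d)%N p.

Definition is_typ (n : nat) (t : {fsfun pnat -> seq nat with [::]}) : bool :=
  all (fun i => is_partition (t i)) (finsupp t) &&
  (\sum_(i <- finsupp t) i * sumn (t i) == n)%N.

Record typ (n : nat) := Typ {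
  tfac :> {fsfun pnat -> seq nat with [::]};
  _ : is_typ n tfac }.
HB.instance Definition _ n := [isSub for @tfac n].
HB.instance Definition _ n := [Choice of typ n by <:].

Definition tlength n (t : typ n) : nat :=
  (\sum_(i <- finsupp t) size (t i))%N.

(* The pair (d, r) is the block of degree d and multiplicity r.  This list,
   like [content] below, matters only up to permutation. *)
Definition blocks n (t : typ n) : seq (nat * nat) :=
  [seq (d, pval r) | r <- finsupp t, d <- t r].

Definition var : Type := (pnat * pnat)%type.
Definition monom : Type := {cmonom var}.

Definition xvar (i j : pnat) : monom := ucm (i, j).

Definition wdeg (m : monom) : nat := (\sum_(v <- finsupp m) v.1 * m v)%N.

Definition squarefree (m : monom) : bool :=
  all (fun v => m v <= 1)%N (finsupp m).

(* A series is its coefficient function.  All the sums \sum_(_ \in _) below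
   have, coefficient by coefficient, only finitely many nonzero terms as soon
   as the degrees and multiplicities are positive, which holds for blocks. *)
Definition series : Type := monom -> rat.

Definition series1 : series := fun m => (m == mone)%:R.

Definition seriesM (f g : series) : series := fun m =>
  \sum_(p \in [set p : monom * monom | mmul p.1 p.2 = m]) f p.1 * g p.2.

(* Replaces every x_(i,j) by x_(i,j)^r. *)
Definition series_pow (r : nat) (f : series) : series := fun m =>
  \sum_(u \in [set u : monom | expcmn u r = m]) f u.

Definition Eplus (d : nat) : series := fun m =>
  (squarefree m && (wdeg m == d))%:R.

Definition Ppoly (d : nat) : series := fun m =>
  \sum_(k \in [set k : pnat | (k %| d)%N])
    \sum_(j \in [set: pnat])
      ((pval k)%:R * (m == expcmn (xvar k j) (d %/ k))%:R : rat).

Definition of_typ (F : nat -> series) n (t : typ n) : series :=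
  \big[seriesM/series1]_(b <- blocks t) series_pow b.2 (F b.1).

Definition expands n (B : typ n -> series) (f : series)
    (c : typ n -> rat) : Prop :=
  forall m : monom, f m = \sum_(r \in [set: typ n]) c r * B r m.

(* A brick is a pair (marking k, length).  Bricks being intervals of cells, a
   decomposition of a row is the list of its bricks from left to right.  The
   list of decomposed rows of the i-th tensor factor is T i. *)
Definition brick : Type := (nat * nat)%type.
Definition bricking : Type := {fsfun pnat -> seq (seq brick) with [::]}.

Definition content (T : bricking) : seq (nat * nat) :=
  [seq ((b.2 %/ 2 ^ b.1)%N, (2 ^ b.1 * pval i)%N)
    | i <- finsupp T, b <- flatten (T i)].

Definition dyadic_tabloid n (s t : typ n) (T : bricking) : Prop :=
  [/\ forall i : pnat,
        [seq sumn [seq b.2 | b <- row] | row : seq brick <- T i] = s i,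
      forall (i : pnat) (row : seq brick) (b : brick),
        row \in T i -> b \in row -> (0 < b.2)%N /\ (2 ^ b.1 %| b.2)%N,
      forall (i : pnat) (row : seq brick),
        row \in T i -> pairwise (fun b b' : brick => b.1 <= b'.1)%N row
    & perm_eq (content T) (blocks t)].

Definition singular (T : bricking) : Prop :=
  forall (i : pnat) (row : seq brick), row \in T i ->
    exists k : nat, forall b : brick, b \in row -> b.1 = k.

Definition PT_sing n (s t : typ n) : set bricking :=
  [set T | dyadic_tabloid s t T /\ singular T].

(* The default (0, 0) is never used: rows of a diagram are nonempty. *)
Definition Lstar (T : bricking) : nat :=
  (\prod_(i <- finsupp T) \prod_(row <- T i) (last (0, 0) row).2)%N.

(* Main.v *)
(* For E(t) = \sum_d E_d t^d = \prod_(k,j) (1 + x_(k,j) t^k), the identity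
   1 / (1 - x) = \prod_l (1 + x^(2^l)) gives \prod_(k,j) 1 / (1 - x_(k,j) t^k) =
   \prod_l E[2^l](t^(2^l)), where E[r] is E with every variable raised to the
   power r.  Applying t d/dt log turns the left-hand side into
   \sum_d P_d t^d, and on the right t E'(t) / E(t) has as coefficient of t^N the
   sum over the compositions (a_1, ..., a_p) of N of
   (-1)^(p-1) a_p E_(a_1) ... E_(a_p).  So P_d is a signed sum over the
   one-marking rows of length d, l being the marking, and P_s is obtained by
   multiplying over the rows of s.

   Uniqueness of the coefficients: if a monomial m = \prod_v v^(m v) occurs in
   the product of the E_(d^r), then m is a product of r-th powers of square-free
   monomials of degree d, whence \sum_v (deg v)^2 (m v) <= \sum d^2 r and
   \sum_v (deg v) (m v)^2 >= \sum d r^2, with equality in both only if the pairs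
   (deg v, m v) are the blocks (d, r).  Hence the matrix of coefficients at the
   monomials \prod x_(d,j)^r (one j for each block) is triangular. *)
Require Import Defs.
From HB Require Import structures.
From mathcomp Require Import all_boot all_order all_algebra.
From mathcomp Require Import finmap monalg boolp classical_sets functions.
From mathcomp Require Import cardinality fsbigop.
From mathcomp Require Import zify ring.

Set Implicit Arguments.
Unset Strict Implicit.
Unset Printing Implicit Defensive.

Import Order.TTheory GRing.Theory Num.Theory.

Local Open Scope classical_set_scope.
Local Open Scope ring_scope.

(** * The ring of series *)

Lemma monom_ext (m1 m2 : monom) : (forall v, m1 v = m2 v) -> m1 = m2.
Proof. by move=> h; apply/eqP/cmP. Qed.

Lemma expcmnS (m : monom) n : expcmn m n.+1 = mmul m (expcmn m n).
Proof.
by case: n => [|n] //=; apply: monom_ext => v; rewrite cmM cm1 addn0.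
Qed.

Local Arguments expcmn : simpl never.

Lemma expcmnE (m : monom) n v : expcmn m n v = (n * m v)%N.
Proof. by elim: n => [|n IH]; rewrite ?expcmnS ?cmM ?IH ?cm1 ?mulSn. Qed.

Lemma expcmn_inj n : (0 < n)%N -> injective (fun m : monom => expcmn m n).
Proof.
move=> n0 a b eab; apply: monom_ext => v; apply/eqP.
by rewrite -(eqn_pmul2l n0) -!expcmnE eab.
Qed.

Lemma expcmnM (a b : monom) n :
  expcmn (mmul a b) n = mmul (expcmn a n) (expcmn b n).
Proof. by apply: monom_ext => v; rewrite cmM !expcmnE cmM mulnDr. Qed.

Lemma expcmn_mul (a : monom) n k : expcmn a (n * k) = expcmn (expcmn a k) n.
Proof. by apply: monom_ext => v; rewrite !expcmnE mulnA. Qed.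

Lemma mmulI (a b c : monom) : mmul a b = mmul a c -> b = c.
Proof.
move=> e; apply: monom_ext => v; apply/eqP.
by rewrite -(eqn_add2l (a v)) -!cmM e.
Qed.

Definition divides (m : monom) : set monom :=
  [set a | exists b, mmul a b = m].

Lemma finite_divides m : finite_set (divides m).
Proof.
pose h (f : {ffun finsupp m -> 'I_(mdeg m).+1}) : monom :=
  [cmonom (f i : nat) | i : finsupp m]%M.
apply: (@sub_finite_set _ _ (h @` setT)); last first.
  by apply: finite_image; exact: finite_finset.
move=> a [b eab]; exists [ffun i : finsupp m => inord (a (val i))] => //.
apply: monom_ext => v; rewrite cmE fsfun_ffun.
have av w : (a w <= m w)%N by rewrite -eab cmM leq_addr.
case: insubP => [u uin <-|vin] /=.
  rewrite ffunE inordK // ltnS mdegE (big_fsetD1 _ (valP u)) /=.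
  exact: leq_trans (av _) (leq_addr _ _).
by apply/esym/eqP; rewrite -leqn0; have := av v; rewrite (fsfun_dflt vin).
Qed.

Definition divs m : {fset monom} := fset_set (divides m).

Lemma divsP m a : reflect (exists b, mmul a b = m) (a \in divs m).
Proof.
by rewrite in_fset_set ?inE; [exact: asboolP | exact: finite_divides].
Qed.

Opaque divs.

Lemma divs_mul m a b : mmul a b \in divs m -> a \in divs m /\ b \in divs m.
Proof.
move=> /divsP[c e]; split; apply/divsP.
  by exists (mmul b c); rewrite mulmA.
by exists (mmul a c); rewrite mulmA [mmul b a]mulmC.
Qed.

Lemma divs_self m : m \in divs m.
Proof. by apply/divsP; exists mone; rewrite mulm1. Qed.

Lemma seriesME (D : {fset monom}) m (f g : series) :
  (forall a b, mmul a b = m -> a \in D /\ b \in D) ->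
  seriesM f g m = \sum_(a <- D) \sum_(b <- D) f a * g b * (mmul a b == m)%:R.
Proof.
move=> hD.
rewrite -(big_allpairs_dep (h := pair) (r2 := fun _ => D : seq monom)
   (F := fun p => f p.1 * g p.2 * (mmul p.1 p.2 == m)%:R)) /=.
under eq_bigr do rewrite mulr_natr mulrb.
rewrite -big_mkcond /= bigfs.
- by apply: eq_fsbigl; apply/seteqP; split=> p /= /eqP.
- by apply: allpairs_uniq; rewrite ?fset_uniq //; move=> [? ?] [? ?].
- move=> [a b] /= /eqP /hD [ha hb] /negP[]; apply/allpairsP.
  by exists (a, b).
Qed.

Lemma seriesME_divs m d (f g : series) : d \in divs m ->
  seriesM f g d =
  \sum_(a <- divs m) \sum_(b <- divs m) f a * g b * (mmul a b == d)%:R.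
Proof. by move=> dm; apply: seriesME => a b e; apply: divs_mul; rewrite e. Qed.

(* An alias, so as not to get the pointwise product of functions. *)
Definition pser : Type := series.
HB.instance Definition _ := gen_eqMixin pser.
HB.instance Definition _ := gen_choiceMixin pser.

Lemma pserP (f g : pser) : (forall m, f m = g m) -> f = g.
Proof. by move=> h; apply/funext. Qed.

Definition pser_zero : pser := fun _ => 0.
Definition pser_opp (f : pser) : pser := fun m => - f m.
Definition pser_add (f g : pser) : pser := fun m => f m + g m.

Fact pser_addA : associative pser_add.
Proof. by move=> f g h; apply: pserP => m; exact: addrA. Qed.
Fact pser_addC : commutative pser_add.
Proof. by move=> f g; apply: pserP => m; exact: addrC. Qed.
Fact pser_add0 : left_id pser_zero pser_add.
Proof. by move=> f; apply: pserP => m; exact: add0r. Qed.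
Fact pser_addN : left_inverse pser_zero pser_opp pser_add.
Proof. by move=> f; apply: pserP => m; exact: addNr. Qed.

HB.instance Definition _ :=
  GRing.isZmodule.Build pser pser_addA pser_addC pser_add0 pser_addN.

Definition pser_mul : pser -> pser -> pser := seriesM.
Definition pser_one : pser := series1.

Fact pser_mulC : commutative pser_mul.
Proof.
move=> f g; apply: pserP => m; rewrite /pser_mul.
rewrite !(seriesME_divs _ _ (divs_self m)) exchange_big /=.
by apply: eq_bigr => a _; apply: eq_bigr => b _; rewrite mulmC [f _ * _]mulrC.
Qed.

Fact pser_mulA : associative pser_mul.
Proof.
move=> f g h; apply: pserP => m; rewrite /pser_mul.
rewrite !(seriesME_divs _ _ (divs_self m)).
set D := divs m.
have sum1 (p : monom) (c : monom -> rat) : p \in D ->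
    \sum_(e <- D) (p == e)%:R * c e = c p.
  move=> pD; rewrite (big_fsetD1 p) //= eqxx mul1r big1_fset ?addr0 // => e.
  by rewrite !inE => /andP[/negPf ne _] _; rewrite eq_sym ne mul0r.
have sum0 (p : monom) (c : monom -> rat) : p \notin D ->
    \sum_(e <- D) (p == e)%:R * c e = 0.
  move=> pD; apply: big1_fset => e eD _.
  by case: eqP pD => [->|]; rewrite ?eD // mul0r.
transitivity (\sum_(a <- D) \sum_(b <- D) \sum_(c <- D)
   f a * g b * h c * (mmul a (mmul b c) == m)%:R).
  apply: eq_bigr => a _.
  transitivity (\sum_(e <- D) \sum_(b <- D) \sum_(c <- D)
      (mmul b c == e)%:R * (f a * g b * h c * (mmul a e == m)%:R)).
    apply: eq_big_seq => e eD.
    rewrite (seriesME_divs _ _ eD) mulr_sumr mulr_suml; apply: eq_bigr => b _.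
    rewrite mulr_sumr mulr_suml; apply: eq_bigr => c _.
    by rewrite [(mmul b c == e)%:R * _]mulrC !mulrA -!mulrA [_%:R * _%:R]mulrC.
  rewrite exchange_big; apply: eq_bigr => b _.
  rewrite exchange_big; apply: eq_bigr => c _ /=.
  have [bcD|bcD] := boolP (mmul b c \in D); first by rewrite sum1.
  rewrite sum0 //; case: eqP => [e|]; rewrite ?mulr0 //.
  by case: (divs_mul (m := m) (a := a) (b := mmul b c)) => [|_];
    rewrite ?e ?divs_self // (negPf bcD).
apply/esym.
transitivity (\sum_(e <- D) \sum_(c <- D) \sum_(a <- D) \sum_(b <- D)
      (mmul a b == e)%:R * (f a * g b * h c * (mmul e c == m)%:R)).
  apply: eq_big_seq => e eD; apply: eq_bigr => c _.
  rewrite (seriesME_divs _ _ eD) !mulr_suml; apply: eq_bigr => a _.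
  rewrite !mulr_suml; apply: eq_bigr => b _.
  by rewrite [RHS]mulrC -!mulrA; congr (_ * (_ * _)); rewrite [LHS]mulrC -mulrA.
rewrite exchange_big /=.
under eq_bigr do rewrite exchange_big /=.
rewrite exchange_big; apply: eq_bigr => a _ /=.
under eq_bigr do rewrite exchange_big /=.
rewrite exchange_big; apply: eq_bigr => b _ /=.
apply: eq_bigr => c _; rewrite mulmA.
have [abD|abD] := boolP (mmul a b \in D); first by rewrite sum1.
rewrite sum0 //; case: eqP => [e|]; rewrite ?mulr0 //.
by case: (divs_mul (m := m) (a := mmul a b) (b := c)) => [|];
  rewrite ?e ?divs_self // (negPf abD).
Qed.

Fact pser_mul1 : left_id pser_one pser_mul.
Proof.
move=> f; apply: pserP => m; rewrite /pser_mul /pser_one /series1.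
rewrite (seriesME_divs _ _ (divs_self m)).
have one_div : mone \in divs m by apply/divsP; exists m; rewrite mul1m.
rewrite (big_fsetD1 _ one_div) /= [X in _ + X]big1_fset ?addr0; last first.
  move=> a; rewrite in_fsetD1 => /andP[/negPf -> _] _.
  by rewrite big1 // => b _; rewrite !mul0r.
rewrite (big_fsetD1 _ (divs_self m)) /= [X in _ + X]big1_fset ?addr0.
  by rewrite mul1m !eqxx mul1r mulr1.
by move=> b; rewrite in_fsetD1 mul1m => /andP[/negPf -> _] _; rewrite mulr0.
Qed.

Fact pser_mulDl : left_distributive pser_mul +%R.
Proof.
move=> f g h; apply: pserP => m; rewrite /pser_mul.
rewrite -[RHS]/(seriesM f h m + seriesM g h m).
rewrite !(seriesME_divs _ _ (divs_self m)) -big_split; apply: eq_bigr => a _.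
by rewrite -big_split; apply: eq_bigr => b _; rewrite !mulrDl.
Qed.

Fact pser_one_neq0 : pser_one != 0.
Proof.
by apply/eqP => /(congr1 (@^~ mone)); rewrite /pser_one /series1 eqxx.
Qed.

HB.instance Definition _ := GRing.Zmodule_isComNzRing.Build pser
  pser_mulA pser_mulC pser_mul1 pser_mulDl pser_one_neq0.

Lemma pser_sumE (I : Type) (r : seq I) (P : pred I) (F : I -> pser) m :
  (\sum_(i <- r | P i) F i) m = \sum_(i <- r | P i) F i m.
Proof. by elim/big_rec2: _ => // i x y _ <-. Qed.

Lemma pserMnE (f : pser) k m : (f *+ k) m = f m *+ k.
Proof. by elim: k => // k IH; rewrite !mulrS -IH. Qed.

Lemma pserME (f g : pser) m : (f * g) m = seriesM f g m.
Proof. by []. Qed.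

Lemma pser_signE k (f : pser) m : ((-1) ^+ k * f) m = (-1) ^+ k * f m.
Proof.
by rewrite -[in LHS]signr_odd -[in RHS]signr_odd !mulr_sign; case: odd.
Qed.

(** * Power substitutions and power sums *)

Lemma series_pow_expcmn r (f : series) (u : monom) : (0 < r)%N ->
  series_pow r f (expcmn u r) = f u.
Proof.
move=> r0; rewrite /series_pow (_ : [set _ | _] = [set u]) ?fsbig_set1 //.
by apply/seteqP; split=> v /= => [/(expcmn_inj r0)|->].
Qed.

Lemma series_pow_eq0 r (f : series) (m : monom) :
  (forall u, expcmn u r <> m) -> series_pow r f m = 0.
Proof. by move=> h; apply: fsbig1 => u /= /h. Qed.

Lemma series_powP r (f g : pser) : (0 < r)%N ->
  (forall u, f u = g (expcmn u r)) ->
  (forall m, (forall u, expcmn u r <> m) -> g m = 0) ->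
  series_pow r f = g.
Proof.
move=> r0 hp hn; apply/funext => m.
have [[u <-]|nu] := pselect (exists u, expcmn u r = m).
  by rewrite series_pow_expcmn.
by rewrite series_pow_eq0 ?hn // => u e; apply: nu; exists u.
Qed.

Lemma series_pow_comp r k (f : pser) : (0 < r)%N -> (0 < k)%N ->
  series_pow r (series_pow k f) = series_pow (r * k) f.
Proof.
move=> r0 k0; have rk0 : (0 < r * k)%N by rewrite muln_gt0 r0.
apply/esym/series_powP => // [u|m nu].
  by rewrite expcmn_mul !series_pow_expcmn.
have [[u um]|nu'] := pselect (exists u, expcmn u r = m); last first.
  by apply: series_pow_eq0 => u e; apply: nu'; exists u.
rewrite -um series_pow_expcmn // series_pow_eq0 // => w e.
by apply: (nu w); rewrite expcmn_mul e.
Qed.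

(* The exponent is r.+1 because series_pow 0 is not a ring morphism. *)
Definition adams r : pser -> pser := series_pow r.+1.

Fact adams_is_zmod_morphism r : zmod_morphism (adams r).
Proof.
move=> f g; apply: series_powP => // [u|m nu].
  rewrite -[RHS]/(adams r f _ - adams r g _) /adams.
  by rewrite !series_pow_expcmn.
by rewrite -[LHS]/(adams r f _ - adams r g _) /adams !series_pow_eq0 ?subr0.
Qed.

Fact adams_is_monoid_morphism r : monoid_morphism (adams r).
Proof.
split.
  apply: series_powP => // [u|m nu].
    rewrite -[LHS]/(series1 _) -[RHS]/(series1 _) /series1; congr (_%:R).
    have e1 : expcmn mone r.+1 = mone :> monom.
      by apply: monom_ext => v; rewrite expcmnE !cm1 muln0.
    by rewrite -[in RHS]e1 (inj_eq (expcmn_inj (ltn0Sn r))).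
  rewrite -[LHS]/(series1 _) /series1; case: eqP => // m1; case: (nu m).
  by apply: monom_ext => v; rewrite m1 expcmnE !cm1 muln0.
move=> f g; apply: series_powP => // [u|m nu]; rewrite [in LHS]pserME.
- rewrite pserME /seriesM.
  pose h (p : monom * monom) := (expcmn p.1 r.+1, expcmn p.2 r.+1).
  symmetry; rewrite -(@fsbig_widen _ _ _ _
    (h @` [set p : monom * monom | mmul p.1 p.2 = u])).
  + rewrite fsbig_image; last first.
      move=> [a b] [c d] _ _ /= [].
      by move=> /(expcmn_inj (ltn0Sn r)) -> /(expcmn_inj (ltn0Sn r)) ->.
    apply: eq_fsbigr => -[a b] _ /=.
    by rewrite /adams !series_pow_expcmn.
  + by move=> _ [[a b] /= <- <-]; rewrite expcmnM.
  + move=> [a b] /= [e nab]; rewrite /adams.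
    have [[a' ea]|na] := pselect (exists a', expcmn a' r.+1 = a); last first.
      rewrite (@series_pow_eq0 _ _ a) ?mul0r // => w e'.
      by apply: na; exists w.
    have [[b' eb]|nb] := pselect (exists b', expcmn b' r.+1 = b); last first.
      rewrite (@series_pow_eq0 _ _ b) ?mulr0 // => w e'.
      by apply: nb; exists w.
    case: nab; exists (a', b'); rewrite /h /= ?ea ?eb //.
    by apply: (@expcmn_inj r.+1) => //; rewrite expcmnM ea eb.
- apply: fsbig1 => -[a b] /= e; rewrite /adams.
  have [[a' ea]|na] := pselect (exists a', expcmn a' r.+1 = a); last first.
    rewrite (@series_pow_eq0 _ _ a) ?mul0r // => w e'.
    by apply: na; exists w.
  rewrite (@series_pow_eq0 _ _ b) ?mulr0 // => w e'.
  by apply: (nu (mmul a' w)); rewrite expcmnM ea e'.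
Qed.

HB.instance Definition _ r := GRing.isZmodMorphism.Build pser pser (adams r)
  (adams_is_zmod_morphism r).
HB.instance Definition _ r := GRing.isMonoidMorphism.Build pser pser (adams r)
  (adams_is_monoid_morphism r).

Lemma adamsE r : (0 < r)%N -> series_pow r = adams r.-1.
Proof. by case: r. Qed.

Lemma finsupp_big_incl (R : Type) (idx : R) (op : Monoid.com_law idx)
    (m : monom) (D : {fset var}) (F : var -> nat -> R) :
  (finsupp m `<=` D)%fset -> (forall v, F v 0%N = idx) ->
  \big[op/idx]_(v <- finsupp m) F v (m v) = \big[op/idx]_(v <- D) F v (m v).
Proof.
move=> mD F0; apply: big_fset_incl => // v _ vm.
by rewrite fsfun_dflt.
Qed.

Lemma wdegM a b : wdeg (mmul a b) = (wdeg a + wdeg b)%N.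
Proof.
rewrite /wdeg mdomD.
rewrite (@finsupp_big_incl _ _ _ a (finsupp a `|` finsupp b)%fset
  (fun v k => v.1 * k)%N) ?fsubsetUl // => [|v]; last exact: muln0.
rewrite (@finsupp_big_incl _ _ _ b (finsupp a `|` finsupp b)%fset
  (fun v k => v.1 * k)%N) ?fsubsetUr // => [|v]; last exact: muln0.
by rewrite -big_split; apply: eq_bigr => v _; rewrite cmM mulnDr.
Qed.

Lemma wdeg1 : wdeg mone = 0%N.
Proof. by rewrite /wdeg mdom1 big_nil. Qed.

Lemma wdeg_exp u r : wdeg (expcmn u r) = (r * wdeg u)%N.
Proof.
by elim: r => [|r IH]; rewrite ?wdeg1 ?expcmnS ?wdegM ?IH ?mulSn.
Qed.

Definition xpow (v : var) q : monom := expcmn (ucm v) q.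

Lemma xpowE v q w : xpow v q w = (q * (v == w))%N.
Proof. by rewrite /xpow expcmnE cmU. Qed.

Lemma xpow_exp v q r : expcmn (xpow v q) r = xpow v (r * q).
Proof. by rewrite /xpow expcmn_mul. Qed.

Lemma wdeg_xpow v q : wdeg (xpow v q) = (q * v.1)%N.
Proof.
rewrite /xpow wdeg_exp /wdeg mdomU big_seq_fset1 cmUU muln1 //.
Qed.

Lemma finsupp_xpow v q : (0 < q)%N -> finsupp (xpow v q) = [fset v]%fset.
Proof.
move=> q0; apply/fsetP => w; rewrite -cmE_neq0 xpowE inE.
by rewrite muln_eq0 negb_or -lt0n q0 eqb0 negbK eq_sym.
Qed.

Lemma xpow_inj v w q k : (0 < q)%N -> xpow v q = xpow w k -> v = w /\ q = k.
Proof.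
move=> q0 e; have := congr1 (fun m : monom => m v) e.
rewrite !xpowE eqxx muln1; case: eqP => [->|_ q00]; first by rewrite muln1.
by rewrite q00 muln0 in q0.
Qed.

Lemma xpow_root v q r u : (0 < r)%N -> expcmn u r = xpow v q ->
  (r %| q)%N /\ u = xpow v (q %/ r).
Proof.
move=> r0 e.
have rq : (r %| q)%N.
  have := congr1 (fun m : monom => m v) e.
  by rewrite expcmnE xpowE eqxx muln1 => <-; rewrite dvdn_mulr.
split=> //; apply: (expcmn_inj r0) => /=.
by rewrite e xpow_exp mulnC divnK.
Qed.

Variant xpow_spec (m : monom) : Prop :=
| IsXpow v q of (0 < q)%N & m = xpow v q
| NotXpow of forall v q, (0 < q)%N -> m <> xpow v q.

Lemma xpowP m : xpow_spec m.
Proof.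
have [[v [q [q0 ->]]]|h] :=
  pselect (exists v q, (0 < q)%N /\ m = xpow v q); first exact: (IsXpow q0).
by apply: NotXpow => v q q0 e; apply: h; exists v, q.
Qed.

Definition vpow_coef (c : nat -> rat) (m : monom) : rat :=
  \sum_(v <- finsupp m) v.1%:R * c (m v) * (m == xpow v (m v))%:R.

(* \sum_(v : var, q > 0, q * v.1 = d) v.1 * c q * v^q *)
Definition wpsum (c : nat -> rat) (d : nat) : pser :=
  fun m => vpow_coef c m * (wdeg m == d)%:R.

Lemma vpow_coef_xpow c v q : (0 < q)%N ->
  vpow_coef c (xpow v q) = v.1%:R * c q.
Proof.
move=> q0; rewrite /vpow_coef finsupp_xpow // big_seq_fset1 xpowE eqxx muln1.
by rewrite eqxx mulr1.
Qed.

Lemma vpow_coef_eq0 c m : (forall v q, (0 < q)%N -> m <> xpow v q) ->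
  vpow_coef c m = 0.
Proof.
move=> h; apply: big1_fset => v; rewrite -cmE_neq0 -lt0n => vm _.
by case: eqP => [/h//|_]; rewrite mulr0.
Qed.

Lemma wpsum_xpow c d v q : (0 < q)%N ->
  wpsum c d (xpow v q) = v.1%:R * c q * (q * v.1 == d)%N%:R.
Proof. by move=> q0; rewrite /wpsum vpow_coef_xpow // wdeg_xpow. Qed.

Lemma wpsum_eq0 c d m : (forall v q, (0 < q)%N -> m <> xpow v q) ->
  wpsum c d m = 0.
Proof. by move=> h; rewrite /wpsum vpow_coef_eq0 // mul0r. Qed.

Lemma series_pow_wpsum_xpow r c d v q : (0 < r)%N -> (0 < q)%N ->
  series_pow r (wpsum c d) (xpow v q) =
  (r %| q)%:R * (v.1%:R * c (q %/ r)%N * (q * v.1 == r * d)%N%:R).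
Proof.
move=> r0 q0; case: (boolP (r %| q)%N) => [rq|nrq]; last first.
  rewrite mul0r series_pow_eq0 // => u /(xpow_root r0)[].
  by rewrite (negPf nrq).
have qr0 : (0 < q %/ r)%N by rewrite divn_gt0 // dvdn_leq.
rewrite -{1}(divnK rq) mulnC -xpow_exp series_pow_expcmn // wpsum_xpow //.
have -> : (q * v.1 == r * d)%N = (q %/ r * v.1 == d)%N.
  by rewrite -{1}(divnK rq) [(_ * r)%N]mulnC -mulnA eqn_pmul2l.
by rewrite mul1r.
Qed.

Lemma series_pow_wpsum_eq0 r c d m : (0 < r)%N ->
  (forall v q, (0 < q)%N -> m <> xpow v q) ->
  series_pow r (wpsum c d) m = 0.
Proof.
move=> r0 h.
have [[u um]|nu] := pselect (exists u, expcmn u r = m); last first.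
  by apply: series_pow_eq0 => u e; apply: nu; exists u.
rewrite -um series_pow_expcmn // wpsum_eq0 // => v q q0 e.
by apply: (h v (r * q)%N); rewrite ?muln_gt0 ?r0 // -um e xpow_exp.
Qed.

Lemma Ppoly_wpsum d : (0 < d)%N -> Ppoly d = wpsum (fun=> 1) d.
Proof.
move=> d0; apply/funext => m; rewrite /Ppoly.
have dk0 (k : Defs.pnat) : (k %| d)%N -> (0 < d %/ k)%N.
  by move=> kd; rewrite divn_gt0 ?(valP k) // dvdn_leq.
case: (xpowP m) => [v q q0 ->|h]; last first.
  rewrite wpsum_eq0 // fsbig1 // => k kd; rewrite fsbig1 // => j _.
  by case: eqP => [e|_]; rewrite ?mulr0 //; case: (h _ _ (dk0 _ kd) e).
rewrite wpsum_xpow // mulr1.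
have [dE|dN] := eqVneq (q * v.1)%N d; last first.
  rewrite mulr0 fsbig1 // => k kd; rewrite fsbig1 // => j _.
  case: eqP => [/(xpow_inj q0)[vE qE]|_]; rewrite ?mulr0 //.
  by case/eqP: dN; rewrite vE qE /= divnK.
have vd : (v.1 %| d)%N by rewrite -dE dvdn_mull.
have qE : q = (d %/ v.1)%N by rewrite -dE mulnK // (valP v.1).
rewrite -(@fsbig_widen _ _ _ _ [set v.1]).
- rewrite fsbig_set1 -(@fsbig_widen _ _ _ _ [set v.2]) //.
    by rewrite fsbig_set1 qE /xvar -surjective_pairing eqxx.
  move=> j [_ /= jv]; case: eqP => [/(xpow_inj q0)[vE _]|_]; rewrite ?mulr0 //.
  by case: jv; rewrite vE.
- by move=> k ->.
- move=> k [_ /= kv]; rewrite fsbig1 // => j _.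
  case: eqP => [/(xpow_inj q0)[vE _]|_]; rewrite ?mulr0 //.
  by case: kv; rewrite vE.
Qed.

Definition esgn (q : nat) : rat := (-1) ^+ q.+1.

(* Logarithm of 1 / (1 - x) = \prod_k (1 + x^(2^k)), coefficient of x^q. *)
Lemma dyadic_sum K q : (0 < q)%N -> (q < 2 ^ K)%N ->
  \sum_(k < K | (2 ^ k %| q)%N) (2 ^ k)%:R * esgn (q %/ 2 ^ k)%N = 1 :> rat.
Proof.
elim: K q => [|K IH] q q0 qK; first by case: q q0 qK => // -[].
rewrite big_mkcond big_ord_recl /= expn0 dvd1n divn1 mul1r -big_mkcond /=.
have [oq|eq] := boolP (odd q).
  rewrite big_pred0 ?addr0; first by rewrite /esgn -signr_odd /= oq.
  move=> k; apply/negP => /(dvdn_trans (dvdn_exp2l 2 (ltn0Sn k))).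
  by rewrite dvdn2 oq.
have qE : q = (2 * q./2)%N by rewrite mul2n even_halfK.
have h0 : (0 < q./2)%N by rewrite half_gt0; case: q q0 eq {qK qE IH} => [|[]].
have hK : (q./2 < 2 ^ K)%N by rewrite -(ltn_pmul2l (isT : 0 < 2)%N) -qE -expnS.
transitivity (-1 + 2%:R * 1 : rat); last by [].
congr (_ + _); first by rewrite /esgn -signr_odd /= eq.
transitivity (2%:R * \sum_(k < K | (2 ^ k %| q./2)%N)
  (2 ^ k)%:R * esgn (q./2 %/ 2 ^ k)%N : rat); last by rewrite IH.
rewrite mulr_sumr; apply: eq_big => k.
  by rewrite /bump /= add1n expnS {1}qE dvdn_pmul2l.
rewrite /bump /= add1n => _.
by rewrite expnS [in LHS]qE divnMl // natrM mulrA.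
Qed.

Lemma Ppoly_dyadic d : (0 < d)%N ->
  Ppoly d = \sum_(k < d | (2 ^ k %| d)%N)
    (series_pow (2 ^ k) (wpsum esgn (d %/ 2 ^ k)%N) : pser) *+ 2 ^ k :> pser.
Proof.
move=> d0; rewrite Ppoly_wpsum //; apply: pserP => m; rewrite pser_sumE.
have p0 k : (0 < 2 ^ k)%N by rewrite expn_gt0.
case: (xpowP m) => [v q q0 ->|h]; last first.
  rewrite wpsum_eq0 // big1 // => k _.
  by rewrite pserMnE series_pow_wpsum_eq0 // mul0rn.
rewrite wpsum_xpow // mulr1.
transitivity (\sum_(k < d | (2 ^ k %| d)%N) v.1%:R * (q * v.1 == d)%N%:R *
  ((2 ^ k %| q)%N%:R * ((2 ^ k)%:R * esgn (q %/ 2 ^ k)%N)) : rat); last first.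
  apply: eq_bigr => k kd.
  rewrite pserMnE series_pow_wpsum_xpow // [(2 ^ k * _)%N]mulnC divnK //.
  rewrite -mulr_natr; ring.
rewrite -mulr_sumr; have [dE|_] := eqVneq (q * v.1)%N d; last first.
  by rewrite mulr0 mul0r.
rewrite mulr1 -[LHS]mulr1; congr (_ * _).
have qd : (q <= d)%N by rewrite -dE leq_pmulr // (valP v.1).
have qd2 : (q < 2 ^ d)%N := leq_ltn_trans qd (ltn_expl d (ltnSn 1)).
apply: etrans (esym (dyadic_sum q0 qd2)) _.
rewrite big_mkcond [RHS]big_mkcond /=; apply: eq_bigr => k _.
case: ifP => kq; last by rewrite mul0r; case: ifP.
have -> : (2 ^ k %| d)%N by rewrite -[X in (_ %| X)%N]dE dvdn_mulr.
by rewrite mul1r.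
Qed.

(** * Newton's identities *)

Lemma squarefreeP (m : monom) : reflect (forall v, (m v <= 1)%N) (squarefree m).
Proof.
apply: (iffP allP) => h v; last by [].
by case: (boolP (v \in finsupp m)) => [/h//|/fsfun_dflt ->].
Qed.

Lemma xpow_mul_div (m : monom) v q : (q <= m v)%N ->
  mmul (divcm m (xpow v q)) (xpow v q) = m.
Proof.
move=> qm; apply: monom_ext => w; rewrite cmM divcmE subnK // xpowE.
by case: eqP => [<-|]; rewrite ?muln1 ?muln0.
Qed.

Lemma vpow_coefE c m b : b \in divs m ->
  vpow_coef c b = \sum_(v <- finsupp m) \sum_(1 <= q < (m v).+1)
    (b == xpow v q)%:R * (v.1%:R * c q).
Proof.
move=> /divsP[a abm]; case: (xpowP b) => [v q q0 bE|h]; last first.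
  rewrite vpow_coef_eq0 // big1 // => v _; rewrite big_nat_cond big1 // => q.
  by rewrite andbT => /andP[q0 _]; case: eqP => [/(h _ _ q0)//|]; rewrite mul0r.
have qm : (q <= m v)%N by rewrite -abm cmM bE xpowE eqxx muln1 leq_addr.
have vm : v \in finsupp m by rewrite -cmE_neq0 -lt0n (leq_trans q0).
rewrite bE vpow_coef_xpow // (big_fsetD1 v) //= [X in _ + X]big1_fset.
  rewrite addr0 (bigD1_seq q) ?mem_index_iota ?iota_uniq ?q0 //= eqxx mul1r.
  rewrite big1 ?addr0 // => k kq; case: eqP => [/(xpow_inj q0)[_ e]|].
    by rewrite e eqxx in kq.
  by rewrite mul0r.
move=> w; rewrite in_fsetD1 => /andP[wv _] _; rewrite big1 // => k _.
case: eqP => [/(xpow_inj q0)[e _]|]; last by rewrite mul0r.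
by rewrite e eqxx in wv.
Qed.

Lemma sum_esgn_squarefree (m : monom) v : v \in finsupp m ->
  \sum_(1 <= q < (m v).+1) esgn q * (squarefree (divcm m (xpow v q)))%:R =
  (squarefree m)%:R :> rat.
Proof.
rewrite -cmE_neq0 -lt0n => mv0.
pose rest := `[< forall w, w != v -> (m w <= 1)%N >].
have sqE q : (q <= m v)%N ->
    squarefree (divcm m (xpow v q)) = rest && (m v - q <= 1)%N.
  move=> qm; apply/squarefreeP/andP => [h|[/asboolP h hv] w].
    split; last by have := h v; rewrite divcmE xpowE eqxx muln1.
    apply/asboolP => w /negPf wv; have := h w.
    by rewrite divcmE xpowE eq_sym wv muln0 subn0.
  rewrite divcmE xpowE; case: eqVneq => [<-|]; rewrite ?muln1 //.
  by rewrite eq_sym => /h; rewrite muln0 subn0.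
have -> : squarefree m = rest && (m v <= 1)%N.
  apply/squarefreeP/andP => [h|[/asboolP h hv] w].
    by split=> //; apply/asboolP => w _; exact: h.
  by have [->|/h] := eqVneq w v.
transitivity (rest%:R * \sum_(1 <= q < (m v).+1)
    esgn q * (m v - q <= 1)%N%:R : rat).
  rewrite mulr_sumr big_nat_cond [RHS]big_nat_cond; apply: eq_bigr => q.
  by rewrite andbT ltnS => /andP[_ qm]; rewrite sqE // -mulnb natrM mulrCA.
rewrite -mulnb natrM; congr (_ * _).
case: (m v) mv0 => // -[_|e _]; first by rewrite big_nat1 subnn mulr1.
rewrite big_nat_recr //= big_nat_recr //= subnn -[(e.+2 - e.+1)%N]/(e.+1 - e)%N.
have sgn0 : esgn e.+1 + esgn e.+2 = 0.
  by rewrite /esgn [X in _ + X]exprS mulN1r subrr.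
rewrite subSnn !mulr1 -addrA sgn0 addr0.
rewrite big_nat_cond big1 // => q; rewrite andbT => /andP[_ qe].
case: leqP => //; rewrite ?mulr0 // => h; exfalso; lia.
Qed.

(* The coefficient form of t E'(t) = E(t) Q(t), with
   E(t) = \prod_v (1 + v t^(deg v)) and Q(t) = \sum_d (wpsum esgn d) t^d. *)
Lemma squarefree_newton (m : monom) :
  \sum_(a <- divs m) \sum_(b <- divs m)
     (squarefree a)%:R * vpow_coef esgn b * (mmul a b == m)%:R =
  (wdeg m)%:R * (squarefree m)%:R :> rat.
Proof.
transitivity (\sum_(v <- finsupp m) \sum_(1 <= q < (m v).+1)
   v.1%:R * (esgn q * (squarefree (divcm m (xpow v q)))%:R) : rat).
  transitivity (\sum_(v <- finsupp m) \sum_(1 <= q < (m v).+1)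
    \sum_(a <- divs m) \sum_(b <- divs m)
     (squarefree a)%:R * ((b == xpow v q)%:R * (v.1%:R * esgn q)) *
     (mmul a b == m)%:R : rat).
    transitivity (\sum_(a <- divs m) \sum_(b <- divs m)
      \sum_(v <- finsupp m) \sum_(1 <= q < (m v).+1)
      (squarefree a)%:R * ((b == xpow v q)%:R * (v.1%:R * esgn q)) *
      (mmul a b == m)%:R : rat).
      apply: eq_bigr => a _; apply: eq_big_seq => b bm.
      rewrite (vpow_coefE _ bm) mulr_sumr mulr_suml; apply: eq_bigr => v _.
      by rewrite mulr_sumr mulr_suml.
    under eq_bigr => a _ do rewrite exchange_big /=.
    rewrite exchange_big /=; apply: eq_bigr => v _.
    under eq_bigr => a _ do rewrite exchange_big /=.
    by rewrite exchange_big.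
  apply: eq_bigr => v _; rewrite big_nat_cond [RHS]big_nat_cond.
  apply: eq_bigr => q; rewrite andbT => /andP[q0 qm].
  have qmv : (q <= m v)%N by [].
  set a0 := divcm m (xpow v q).
  have am : mmul a0 (xpow v q) = m by exact: xpow_mul_div.
  have a0m : a0 \in divs m by apply/divsP; exists (xpow v q).
  have xm : xpow v q \in divs m by apply/divsP; exists a0; rewrite mulmC.
  rewrite (big_fsetD1 _ a0m) /= [X in _ + X]big1_fset ?addr0; last first.
    move=> a; rewrite in_fsetD1 => /andP[/eqP aa _] _; apply: big1 => b _.
    case: eqP => [->|]; last by rewrite !(mul0r, mulr0).
    case: eqP => [e|]; last by rewrite mulr0.
    by case: aa; apply: (@mmulI (xpow v q)); rewrite mulmC e mulmC.
  rewrite (big_fsetD1 _ xm) /= [X in _ + X]big1_fset ?addr0; last first.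
    move=> b; rewrite in_fsetD1 => /andP[/negPf -> _] _.
    by rewrite !(mul0r, mulr0).
  by rewrite am !eqxx mulr1 mul1r mulrC mulrA.
under eq_big_seq => v vm do rewrite -mulr_sumr sum_esgn_squarefree //.
rewrite -mulr_suml; case: squarefreeP => [sm|_]; rewrite ?mulr0 // !mulr1.
rewrite /wdeg natr_sum; apply: eq_big_seq => v; rewrite -cmE_neq0 => vm.
suff -> : m v = 1%N by rewrite muln1.
by have := sm v; case: (m v) vm => [|[]].
Qed.

Lemma vpow_coef1 c : vpow_coef c mone = 0.
Proof. by rewrite /vpow_coef mdom1 big_seq_fset0. Qed.

Lemma wdeg_eq0 m : wdeg m = 0%N -> m = mone.
Proof.
move=> m0; apply: monom_ext => v; rewrite cm1.
case: (boolP (v \in finsupp m)) => [vm|/fsfun_dflt //].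
move: m0; rewrite /wdeg (big_fsetD1 v) //= => /eqP; rewrite addn_eq0 muln_eq0.
by case/andP => /orP[/eqP v0|/eqP //]; have := valP v.1; rewrite /= v0.
Qed.

Lemma Eplus_newton N :
  (Eplus N : pser) *+ N =
  \sum_(i < N) (Eplus i : pser) * wpsum esgn (N - i).
Proof.
apply: pserP => m; rewrite pserMnE pser_sumE.
transitivity ((wdeg m == N)%:R * ((wdeg m)%:R * (squarefree m)%:R) : rat).
  rewrite /Eplus; case: eqVneq => [->|_]; rewrite ?andbF ?mul0r ?mul0rn //.
  by rewrite andbT mul1r mulr_natl.
rewrite -squarefree_newton mulr_sumr.
under [RHS]eq_bigr do rewrite pserME (seriesME_divs _ _ (divs_self m)).
rewrite exchange_big /=; apply: eq_bigr => a _.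
rewrite exchange_big mulr_sumr /=; apply: eq_bigr => b _.
case: (eqVneq (mmul a b) m) => [abm|_]; last first.
  by rewrite !mulr0 big1 // => i _; rewrite mulr0.
have [b1|b1] := eqVneq (wdeg b) 0%N.
  rewrite (wdeg_eq0 b1) vpow_coef1 !(mulr0, mul0r) big1 // => i _.
  by rewrite /wpsum vpow_coef1 mul0r mulr0 mul0r.
under eq_bigr do rewrite mulr1.
rewrite mulr1 /Eplus /wpsum -abm wdegM.
have [aN|aN] := ltnP (wdeg a) N; last first.
  have -> : (wdeg a + wdeg b == N)%N = false by apply/negP => /eqP; lia.
  rewrite mul0r big1 // => i _; have iN := ltn_ord i.
  have -> : (wdeg a == i)%N = false by apply/negP => /eqP; lia.
  by rewrite andbF mul0r.
rewrite (bigD1 (Ordinal aN)) //= eqxx andbT big1 ?addr0; last first.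
  move=> i /eqP ia; case: eqP => [ai|]; last by rewrite andbF mul0r.
  by case: ia; apply/val_inj.
have -> : (wdeg b == N - wdeg a)%N = (wdeg a + wdeg b == N)%N.
  by apply/eqP/eqP; lia.
by rewrite [LHS]mulrC mulrA.
Qed.

(** * Expansion over the rows of tabloids *)

(* n is fuel; all the compositions of N are listed once N <= n. *)
Fixpoint compositions (n N : nat) : seq (seq nat) :=
  if N == 0%N then [:: [::]] else
  if n is n'.+1 then
    [seq a.+1 :: c | a <- iota 0 N, c <- compositions n' (N - a.+1)%N]
  else [::].

Lemma compositionsS n N : compositions n.+1 N.+1 =
  [seq a.+1 :: c | a <- iota 0 N.+1, c <- compositions n (N - a)%N].
Proof. by []. Qed.

Local Arguments iota : simpl never.

Lemma mem_compositions n N c : (N <= n)%N ->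
  (c \in compositions n N) = all (leq 1) c && (sumn c == N).
Proof.
elim: n N c => [|n IH] N c Nn.
  move: Nn; rewrite leqn0 => /eqP -> /=; rewrite inE.
  by case: c => //= -[|a] c //=; rewrite addSn andbF.
case: N Nn => [|N] Nn.
  by rewrite /= inE; case: c => //= -[|a] c //=; rewrite addSn andbF.
rewrite compositionsS; apply/allpairsPdep/andP.
  move=> [a [c' []]]; rewrite mem_iota /= => aN hc ->.
  move: hc; rewrite IH; last by lia.
  by case/andP => ac /eqP sc /=; rewrite ac; split=> //; apply/eqP; lia.
case: c => [[]//|[|a] c [] //= ac /eqP sc].
exists a, c; rewrite mem_iota IH ?ac; last by lia.
by split=> //; [lia | apply/eqP; lia].
Qed.

Lemma uniq_compositions n N : uniq (compositions n N).
Proof.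
elim: n N => [|n IH] [|N] //; rewrite compositionsS.
apply: allpairs_uniq_dep; rewrite ?iota_uniq // => -[a c] [b d] _ _ /= [-> ->].
by [].
Qed.

Lemma newton_compositions (R : comNzRingType) (e q : nat -> R) n N :
  e 0%N = 1 ->
  (forall M, e M *+ M = \sum_(i < M) e i * q (M - i)%N) ->
  (0 < N <= n)%N ->
  q N = \sum_(c <- compositions n N)
    (-1) ^+ (size c).+1 * (\prod_(a <- c) e a) *+ last 0%N c.
Proof.
move=> e0 newt; elim: n N => [|n IH] [|N] // Nn.
rewrite compositionsS big_allpairs_dep.
rewrite -[iota 0 N.+1]/(index_iota 0 N.+1) big_mkord big_ord_recr /= subnn.
have -> : compositions n 0 = [:: [::]] by case: (n).
rewrite !big_seq1 /= sqrrN expr1n mul1r newt big_ord_recl e0 mul1r subn0.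
rewrite addrCA -[LHS]addr0; congr (_ + _).
rewrite -big_split big1 // => a _ /=; rewrite /bump /= add1n subSS.
rewrite (IH (N - a)%N); last by have := ltn_ord a; lia.
rewrite mulr_sumr -big_split big1_seq //= => c.
rewrite mem_compositions; last by have := ltn_ord a; lia.
case: c => [|b c /= _].
  by rewrite /= => /eqP h; have := ltn_ord a; lia.
rewrite !big_cons -!mulrnAr [in X in X + _]exprS mulN1r mulNr.
by rewrite mulrCA mulrnAr mulrnAr addNr.
Qed.

Definition dyadic_rows d : seq (seq brick) :=
  [seq [seq (k, 2 ^ k * a)%N | a <- c] |
    k <- [seq k <- iota 0 d | (2 ^ k %| d)%N],
    c <- compositions d (d %/ 2 ^ k)%N].

Lemma mem_dyadic_rows d (row : seq brick) : (0 < d)%N ->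
  row \in dyadic_rows d <->
  [/\ sumn [seq b.2 | b <- row] = d,
      forall b : brick, b \in row -> (0 < b.2)%N /\ (2 ^ b.1 %| b.2)%N
    & exists k : nat, forall b : brick, b \in row -> b.1 = k].
Proof.
move=> d0; have p0 k : (0 < 2 ^ k)%N by rewrite expn_gt0.
have sumE k (c : seq nat) :
    sumn [seq b.2 | b <- [seq (k, 2 ^ k * a)%N | a <- c] : seq brick] =
    (2 ^ k * sumn c)%N.
  by elim: c => [|a c /= ->]; rewrite ?muln0 //= mulnDr.
split.
  case/allpairsPdep => k [c []]; rewrite mem_filter => /andP[kd _].
  rewrite mem_compositions ?leq_div // => /andP[/allP c0 /eqP sc] ->.
  split; first by rewrite sumE sc mulnC divnK.
  - by move=> _ /mapP[a /c0 a0 ->] /=; rewrite muln_gt0 p0 a0 dvdn_mulr.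
  - by exists k => _ /mapP[a _ ->].
case=> sr br [k kr].
pose c := [seq (b.2 %/ 2 ^ k)%N | b <- row].
have rowE : row = [seq (k, 2 ^ k * a)%N | a <- c].
  rewrite -map_comp -[LHS]map_id; apply/eq_in_map => -[k' l] bin /=.
  have /= e := kr _ bin; rewrite e.
  by have [_ /= ] := br _ bin; rewrite e => h; rewrite mulnC divnK.
have sc : (2 ^ k * sumn c)%N = d by rewrite -sumE -rowE.
have kd : (2 ^ k %| d)%N by rewrite -sc dvdn_mulr.
apply/allpairsPdep; exists k, c; split=> //.
  rewrite mem_filter kd mem_iota /=.
  exact: leq_trans (ltn_expl k (ltnSn 1)) (dvdn_leq d0 kd).
rewrite mem_compositions ?leq_div // -sc mulKn // eqxx andbT.
apply/allP => _ /mapP[b bin ->]; have [b0] := br _ bin.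
by rewrite (kr _ bin) => kb; rewrite divn_gt0 // dvdn_leq.
Qed.

Lemma uniq_dyadic_rows d : (0 < d)%N -> uniq (dyadic_rows d).
Proof.
move=> d0; have p0 k : (0 < 2 ^ k)%N by rewrite expn_gt0.
apply: allpairs_uniq_dep; first by rewrite filter_uniq ?iota_uniq.
  by move=> k _; exact: uniq_compositions.
move=> _ [l c'] /allpairsPdep[k [c [kin cin ->]]] _ /=.
have: c != [::].
  move: kin cin; rewrite mem_filter => /andP[kd _].
  rewrite mem_compositions ?leq_div //; case: c => //= /eqP e.
  by move: d0; rewrite -(divnK kd) -e.
case: c c' {cin} => // a c [|b c'] //= _ [-> ].
move=> /eqP; rewrite eqn_pmul2l // => /eqP -> e; suff -> : c = c' by [].
by apply: inj_map e => x y [] /eqP; rewrite eqn_pmul2l // => /eqP.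
Qed.

Lemma Eplus0 : Eplus 0 = 1 :> pser.
Proof.
apply: pserP => m; rewrite -[RHS]/((m == mone)%:R) /Eplus; congr (_%:R).
apply: congr1; apply/andP/eqP => [[_ /eqP/wdeg_eq0 //]|->].
by rewrite wdeg1; split=> //; apply/squarefreeP => v; rewrite cm1.
Qed.

Lemma Ppoly_rows r d : (0 < r)%N -> (0 < d)%N ->
  series_pow r (Ppoly d) = \sum_(row <- dyadic_rows d)
    (-1) ^+ (size row).+1 *
    (\prod_(b <- row)
       (series_pow (2 ^ b.1 * r) (Eplus (b.2 %/ 2 ^ b.1)) : pser))
    *+ (last (0, 0)%N row).2 :> pser.
Proof.
move=> r0 d0; have p0 k : (0 < 2 ^ k)%N by rewrite expn_gt0.
rewrite Ppoly_dyadic // adamsE // rmorph_sum /=.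
rewrite /dyadic_rows big_allpairs_dep /= big_filter.
rewrite -[d in iota _ d]subn0 big_mkord.
apply: eq_bigr => k kd; rewrite rmorphMn /= -adamsE // series_pow_comp //.
rewrite adamsE ?muln_gt0 ?r0 ?p0 //.
rewrite (@newton_compositions pser Eplus (wpsum esgn) d) ?Eplus0 //; last first.
- by rewrite divn_gt0 // dvdn_leq // leq_div.
- exact: Eplus_newton.
rewrite rmorph_sum -sumrMnl; apply: eq_bigr => c _ /=.
rewrite rmorphMn rmorphM rmorphXn rmorphN1 rmorph_prod size_map big_map /=.
rewrite -mulrnA; congr (_ * _ *+ _).
  apply: eq_bigr => a _.
  by rewrite mulKn // [in RHS]adamsE ?muln_gt0 ?r0 ?p0 // mulnC.
by case: c => [|a c]; rewrite ?mul0n //= last_map mulnC.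
Qed.

Fixpoint cart (T : Type) (ls : seq (seq T)) : seq (seq T) :=
  if ls is l :: ls' then [seq x :: xs | x <- l, xs <- cart ls'] else [:: [::]].

Lemma mem_cart (T : eqType) (ls : seq (seq T)) (xs : seq T) :
  (xs \in cart ls) = all2 (fun x (l : seq T) => x \in l) xs ls.
Proof.
elim: ls xs => [|l ls IH] [|x xs] //=.
  by apply/negP => /allpairsP[[y ys] []].
apply/allpairsP/andP => [[[y ys] /= [yl ysl [-> ->]]]|[xl xsl]].
  by rewrite yl -IH.
by exists (x, xs); split=> //=; rewrite IH.
Qed.

Lemma uniq_cart (T : eqType) (ls : seq (seq T)) : all uniq ls -> uniq (cart ls).
Proof.
elim: ls => //= l ls IH /andP[ul /IH uls].
by apply: allpairs_uniq => // -[x xs] [y ys] _ _ /= [-> ->].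
Qed.

Lemma prod_sum_cart (R : comNzRingType) (I T : Type) (s : seq I)
    (X : I -> seq T) (G : I -> T -> R) :
  \prod_(i <- s) \sum_(x <- X i) G i x =
  \sum_(xs <- cart [seq X i | i <- s]) \prod_(p <- zip s xs) G p.1 p.2.
Proof.
elim: s => [|i s IH] /=; first by rewrite big_seq1 !big_nil.
rewrite big_cons IH big_allpairs_dep mulr_suml; apply: eq_bigr => x _.
by rewrite mulr_sumr; apply: eq_bigr => xs _; rewrite /= big_cons.
Qed.

Lemma size_cart (T : eqType) (ls : seq (seq T)) xs :
  xs \in cart ls -> size xs = size ls.
Proof. by rewrite mem_cart all2E => /andP[/eqP]. Qed.

Definition factor_rows (p : seq nat) : seq (seq (seq brick)) :=
  cart [seq dyadic_rows d | d <- p].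

Lemma mem_factor_rows p (R : seq (seq brick)) : all (leq 1) p ->
  R \in factor_rows p <->
  [/\ [seq sumn [seq b.2 | b <- row] | row : seq brick <- R] = p,
      forall (row : seq brick) (b : brick), row \in R -> b \in row ->
        (0 < b.2)%N /\ (2 ^ b.1 %| b.2)%N
    & forall row : seq brick, row \in R ->
        exists k : nat, forall b : brick, b \in row -> b.1 = k].
Proof.
rewrite /factor_rows mem_cart; elim: p R => [|d p IH] [|row R] //=.
- by split=> // -[].
- by split=> // -[].
move=> /andP[d0 p0]; split.
  move=> /andP[/(mem_dyadic_rows _ d0)[sr br kr] /(IH _ p0)[sR bR kR]].
  split; first by rewrite sr sR.
  - by move=> r b; rewrite inE => /predU1P[->|rR]; [exact: br | exact: bR].
  - by move=> r; rewrite inE => /predU1P[->|rR]; [exact: kr | exact: kR].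
case=> -[sr sR] bR kR; apply/andP; split.
  apply/(mem_dyadic_rows _ d0); split=> //.
    by move=> b; apply: bR; rewrite mem_head.
  by apply: kR; rewrite mem_head.
apply/(IH _ p0); split=> // [r b rR|r rR].
  by apply: bR; rewrite inE rR orbT.
by apply: kR; rewrite inE rR orbT.
Qed.

Lemma uniq_factor_rows p : all (leq 1) p -> uniq (factor_rows p).
Proof.
move=> /allP p0; apply: uniq_cart; apply/allP => _ /mapP[d /p0 d0 ->].
exact: uniq_dyadic_rows.
Qed.

Lemma typ_pos n (t : typ n) (i : Defs.pnat) : all (leq 1) (t i).
Proof.
case: (boolP (i \in finsupp t)) => [it|/fsfun_dflt -> //].
by case/andP: (valP t) => /allP /(_ _ it) /andP[].
Qed.

Definition tabulate (S : {fset Defs.pnat}) (Rs : seq (seq (seq brick))) :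
    bricking :=
  [fsfun i in S => nth [::] Rs (index i S)].

Lemma map_tabulate (S : {fset Defs.pnat}) Rs : size Rs = size S ->
  [seq tabulate S Rs i | i <- S] = Rs.
Proof.
move=> sz; apply: (@eq_from_nth _ [::]); rewrite size_map // => k kS.
pose i0 := @PNat 1 isT.
rewrite (nth_map i0) // fsfun_fun mem_nth //.
by rewrite index_uniq ?fset_uniq.
Qed.

Lemma all2_map_same (I A B : Type) (r : A -> B -> bool) (f : I -> A)
    (g : I -> B) (s : seq I) :
  all2 r [seq f i | i <- s] [seq g i | i <- s] = all (fun i => r (f i) (g i)) s.
Proof. by elim: s => //= i s ->. Qed.

Definition tabloids n (s : typ n) : seq bricking :=
  [seq tabulate (finsupp s) Rs
    | Rs <- cart [seq factor_rows (s i) | i <- finsupp s]].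

Lemma mem_tabloids_factor n (s : typ n) (T : bricking) :
  T \in tabloids s <-> forall i, T i \in factor_rows (s i).
Proof.
split.
  case/mapP => Rs Rin -> i; have szR := size_cart Rin.
  rewrite size_map in szR.
  case: (boolP (i \in finsupp s)) => iS; last first.
    by rewrite fsfun_fun (negPf iS) fsfun_dflt.
  move: Rin; rewrite mem_cart -{1}(map_tabulate szR) all2_map_same.
  by move/allP; apply.
move=> TX; apply/mapP; exists [seq T i | i <- finsupp s].
  by rewrite mem_cart all2_map_same; apply/allP => i _; exact: TX.
apply/fsfunP => i; rewrite fsfun_fun; case: ifP => iS.
  by rewrite (nth_map i) ?index_mem // nth_index.
by have := TX i; rewrite (fsfun_dflt (negbT iS)) inE => /eqP.
Qed.

Lemma mem_tabloids n (s : typ n) (T : bricking) :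
  T \in tabloids s <->
  [/\ forall i : Defs.pnat,
        [seq sumn [seq b.2 | b <- row] | row : seq brick <- T i] = s i,
      forall (i : Defs.pnat) (row : seq brick) (b : brick),
        row \in T i -> b \in row -> (0 < b.2)%N /\ (2 ^ b.1 %| b.2)%N,
      forall (i : Defs.pnat) (row : seq brick),
        row \in T i -> pairwise (fun b b' : brick => b.1 <= b'.1)%N row
    & singular T].
Proof.
rewrite mem_tabloids_factor; split.
  move=> h; have {}h i := (mem_factor_rows (T i) (typ_pos s i)).1 (h i).
  split=> [i|i row b|i row rT|i row]; have [sT bT kT] := h i.
  - exact: sT.
  - exact: bT.
  - have [k kr] := kT _ rT; apply/(pairwiseP (0, 0)%N) => x y.
    by move=> /(mem_nth (0, 0)%N)/kr -> /(mem_nth (0, 0)%N)/kr ->.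
  - exact: kT.
case=> sT bT _ kT i; apply/(mem_factor_rows _ (typ_pos s i)).
by split=> [|row b|row]; [exact: sT | exact: bT | exact: kT].
Qed.

Lemma uniq_tabloids n (s : typ n) : uniq (tabloids s).
Proof.
rewrite map_inj_in_uniq.
  apply: uniq_cart; apply/allP => _ /mapP[i _ ->].
  exact: uniq_factor_rows (typ_pos s i).
move=> R1 R2 /size_cart; rewrite size_map => s1.
move=> /size_cart; rewrite size_map => s2 e.
by rewrite -(map_tabulate s1) -(map_tabulate s2) e.
Qed.

Lemma PT_singE n (s t : typ n) :
  PT_sing s t =
  [set` [seq T <- tabloids s | perm_eq (content T) (blocks t)]].
Proof.
apply/seteqP; split=> T /=; rewrite mem_filter.
  by move=> [[sT bT pT cT] kT]; rewrite cT; apply/mem_tabloids.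
by move=> /andP[cT /mem_tabloids[sT bT pT kT]].
Qed.

Lemma finsupp_tabloid n (s : typ n) T : T \in tabloids s ->
  finsupp T = finsupp s :> {fset Defs.pnat}.
Proof.
move=> /mem_tabloids[sT _ _ _]; apply/fsetP => i.
by rewrite !mem_finsupp -sT; case: (T i).
Qed.

Lemma big_zip_map (R : Type) (idx : R) (op : Monoid.law idx) (I A : Type)
    (s : seq I) (f : I -> A) (F : I -> A -> R) :
  \big[op/idx]_(p <- zip s [seq f i | i <- s]) F p.1 p.2 =
  \big[op/idx]_(i <- s) F i (f i).
Proof. by elim: s => [|i s IH] /=; rewrite ?big_nil ?big_cons //= IH. Qed.

Lemma of_typ_tabloids n (s : typ n) (G : Defs.pnat -> seq brick -> pser) :
  \prod_(i <- finsupp s) \prod_(d <- s i) \sum_(row <- dyadic_rows d) G i row =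
  \sum_(T <- tabloids s) \prod_(i <- finsupp T) \prod_(row <- T i) G i row.
Proof.
transitivity (\prod_(i <- finsupp s) \sum_(R <- factor_rows (s i))
    \prod_(row <- R) G i row).
  apply: eq_bigr => i _; rewrite prod_sum_cart; apply: eq_big_seq => R Rin.
  have szR := size_cart Rin; rewrite size_map in szR.
  by rewrite -(big_map snd predT (G i)) -/(unzip2 _) unzip2_zip ?szR.
rewrite prod_sum_cart /tabloids big_map; apply: eq_big_seq => Rs Rin.
have szR := size_cart Rin; rewrite size_map in szR.
rewrite (@finsupp_tabloid _ s) ?map_f // -[in LHS](map_tabulate szR).
by rewrite (@big_zip_map _ _ _ _ _ _ _ (fun i R => \prod_(row <- R) G i row)).
Qed.

Lemma size_content T :
  size (content T) = (\sum_(i <- finsupp T) \sum_(row <- T i) size row)%N.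
Proof.
rewrite /content size_allpairs_dep sumnE big_map; apply: eq_bigr => i _.
by rewrite size_flatten sumnE big_map.
Qed.

Lemma tlength_tabloid n (s : typ n) T : T \in tabloids s ->
  tlength s = (\sum_(i <- finsupp T) \sum_(row <- T i) 1)%N.
Proof.
move=> Ts; rewrite (finsupp_tabloid Ts); apply: eq_bigr => i _.
by have [sT _ _ _] := (mem_tabloids s T).1 Ts; rewrite -sT size_map sum1_size.
Qed.

Definition block_prod (F : nat -> series) (bs : seq (nat * nat)) : pser :=
  \prod_(b <- bs) (series_pow b.2 (F b.1) : pser).

Lemma of_typE F n (t : typ n) : of_typ F t = block_prod F (blocks t).
Proof. by []. Qed.

Lemma of_typ_Ppoly n (s : typ n) :
  of_typ Ppoly s = \sum_(T <- tabloids s)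
    (-1) ^+ (size (content T) + tlength s) * block_prod Eplus (content T)
    *+ Lstar T :> pser.
Proof.
rewrite of_typE /block_prod /blocks big_allpairs_dep /=.
transitivity (\prod_(i <- finsupp s) \prod_(d <- s i)
   \sum_(row <- dyadic_rows d) ((-1) ^+ (size row).+1 *
    (\prod_(b <- row)
       (series_pow (2 ^ b.1 * i) (Eplus (b.2 %/ 2 ^ b.1)%N) : pser))
    *+ (last (0, 0)%N row).2) : pser).
  apply: eq_bigr => i _; apply: eq_big_seq => d ds.
  by rewrite (Ppoly_rows (valP i) (allP (typ_pos s i) _ ds)).
rewrite of_typ_tabloids; apply: eq_big_seq => T Ts.
rewrite (tlength_tabloid Ts) size_content /Lstar /content -big_split /=.
rewrite big_allpairs_dep -mulr_natr natr_prod -prodrXr -!big_split /=.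
apply: eq_bigr => i _.
rewrite natr_prod -[X in _ ^+ X]big_split -prodrXr big_flatten -!big_split /=.
by apply: eq_bigr => row _; rewrite -mulr_natr addn1.
Qed.

(** * Linear independence *)

Definition fsblocks (f : {fsfun Defs.pnat -> seq nat with [::]}) :
    seq (nat * nat) :=
  [seq (d, pval r) | r <- finsupp f, d <- f r].

Lemma count_fsblocks f d (i : Defs.pnat) :
  count_mem (d, pval i) (fsblocks f) = count_mem d (f i).
Proof.
rewrite /fsblocks count_flatten -map_comp sumnE big_map.
have cE r :
    (count_mem (d, pval i) \o (fun r => [seq (d, pval r) | d <- f r])) r =
    ((r == i) * count_mem d (f r))%N.
  rewrite /= count_map; case: eqVneq => [->|ri].
    by rewrite mul1n; apply: eq_count => x; rewrite /= xpair_eqE eqxx andbT.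
  rewrite mul0n -(count_pred0 (f r)); apply: eq_count => x.
  by rewrite /= xpair_eqE (inj_eq val_inj) (negPf ri) andbF.
under eq_bigr do rewrite cE.
case: (boolP (i \in finsupp f)) => iF.
  rewrite (big_fsetD1 i) //= eqxx mul1n big1_fset ?addn0 // => r.
  by rewrite in_fsetD1 => /andP[/negPf -> _] _.
rewrite (fsfun_dflt iF) big1_fset // => r rF _.
by case: eqP iF => [<-|]; rewrite ?rF.
Qed.

Lemma sum_fsblocks f :
  (\sum_(b <- fsblocks f) b.1 * b.2 = \sum_(i <- finsupp f) i * sumn (f i))%N.
Proof.
rewrite /fsblocks big_allpairs_dep; apply: eq_bigr => i _.
by rewrite sumnE big_distrr; apply: eq_bigr => d _; rewrite mulnC.
Qed.

Lemma perm_eq_count (T : eqType) (s1 s2 : seq T) :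
  (forall x, x \in s1 ++ s2 -> count_mem x s1 = count_mem x s2) ->
  perm_eq s1 s2.
Proof. by move=> h; apply/allP => x /h /eqP. Qed.

Lemma blocks_inj n (t u : typ n) : perm_eq (blocks t) (blocks u) -> t = u.
Proof.
move=> /permP tu; apply/val_inj/fsfunP => i.
have sorted_typ (v : typ n) : sorted geq (v i).
  case: (boolP (i \in finsupp v)) => [iv|/fsfun_dflt -> //].
  by case/andP: (valP v) => /allP /(_ _ iv) /andP[].
apply: (@sorted_eq _ geq) => //.
- by move=> a b c /= ba ac; exact: leq_trans ac ba.
- by move=> a b; rewrite /geq /= => /anti_leq.
- exact: sorted_typ.
- exact: sorted_typ.
- by apply: perm_eq_count => d _; rewrite -!count_fsblocks; exact: tu.
Qed.

Definition pos_block (b : nat * nat) : bool := (0 < b.1)%N && (0 < b.2)%N.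

Lemma blocks_pos n (t : typ n) : all pos_block (blocks t).
Proof.
apply/allP => _ /allpairsPdep[i [d [_ di ->]]].
by rewrite /pos_block (allP (typ_pos t i) _ di) (valP i).
Qed.

Lemma sum_blocks n (t : typ n) : (\sum_(b <- blocks t) b.1 * b.2 = n)%N.
Proof. by rewrite sum_fsblocks; case/andP: (valP t) => _ /eqP. Qed.

Lemma typ_of_blocks n (bs : seq (nat * nat)) : all pos_block bs ->
  (\sum_(b <- bs) b.1 * b.2 = n)%N -> exists t : typ n, perm_eq bs (blocks t).
Proof.
move=> /allP pos sumE; pose p1 := @PNat 1 isT.
pose parts (i : Defs.pnat) := sort geq [seq b.1 | b <- bs & b.2 == pval i].
pose S := [fset insubd p1 b.2 | b in bs]%fset.
pose f : {fsfun Defs.pnat -> seq nat with [::]} := [fsfun i in S => parts i].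
have fE i : f i = parts i.
  rewrite fsfun_fun; case: ifPn => // iS; rewrite /parts.
  suff -> : [seq b <- bs | b.2 == pval i] = [::] by [].
  apply/eqP; rewrite -size_eq0 size_filter eqn0Ngt -has_count.
  apply/hasPn => b bbs; apply: contra iS => /eqP bi; apply/imfsetP.
  by exists b => //; rewrite bi valKd.
have perm : perm_eq bs (fsblocks f).
  apply: perm_eq_count => -[d r]; rewrite mem_cat => drin.
  have r0 : (0 < r)%N.
    case/orP: drin => [/pos /andP[]//|/allpairsPdep[i [e [_ _ [_ ->]]]]].
    exact: valP i.
  rewrite -[r]/(pval (PNat r0)) count_fsblocks fE /parts.
  have /permP -> := permEl (perm_sort geq [seq b.1 | b <- bs & b.2 == r]).
  rewrite count_map count_filter; apply: eq_count => b /=.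
  by case: b => x y; rewrite xpair_eqE.
have ftyp : is_typ n f.
  apply/andP; split; last by rewrite -sum_fsblocks -(perm_big _ perm) sumE.
  apply/allP => i _; rewrite /is_partition fE sort_sorted; last first.
    by move=> a b; rewrite /geq /= orbC leq_total.
  apply/allP => d; rewrite mem_sort => /mapP[b]; rewrite mem_filter.
  by case/andP => _ /pos /andP[b0 _] ->.
by exists (Typ ftyp).
Qed.

Lemma block_bounds n (t : typ n) d r : (d, r) \in blocks t ->
  (d <= n)%N /\ (r <= n)%N.
Proof.
move=> drt; have /andP[/= d0 r0] := allP (blocks_pos t) _ drt.
have : (d * r <= n)%N.
  by rewrite -[X in (_ <= X)%N](sum_blocks t) (big_rem _ drt) leq_addr.
move=> h; split; apply: leq_trans h; first exact: leq_pmulr.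
exact: leq_pmull.
Qed.

Lemma size_blocks_le n (t : typ n) : (size (blocks t) <= n)%N.
Proof.
rewrite -[X in (_ <= X)%N](sum_blocks t) -sum1_size !big_seq.
apply: leq_sum => b /(allP (blocks_pos t)) /andP[].
by rewrite muln_gt0 => -> ->.
Qed.

Lemma finite_typ n : finite_set [set: typ n].
Proof.
pose h (t : typ n) : {ffun 'I_n.+1 * 'I_n.+1 -> 'I_n.+1} :=
  [ffun p => inord (count_mem (val p.1, val p.2) (blocks t))].
have cle (t : typ n) x : (count_mem x (blocks t) < n.+1)%N.
  by rewrite ltnS (leq_trans (count_size _ _)) // size_blocks_le.
have h_inj : injective h.
  move=> t u /ffunP tu; apply/blocks_inj/perm_eq_count => -[d r].
  rewrite mem_cat => drin.
  have [dn rn] : (d <= n)%N /\ (r <= n)%N.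
    by case/orP: drin => /block_bounds.
  have := tu (inord d, inord r); rewrite !ffunE /= !inordK ?ltnS //.
  by move=> /(congr1 val); rewrite /= !inordK.
rewrite -(preimage_setT h); apply: finite_preimage; last exact: finite_finset.
by move=> t u _ _ /h_inj.
Qed.

Definition mblocks (m : monom) : seq (nat * nat) :=
  [seq (pval v.1, m v) | v <- finsupp m].

Definition deg_moment (bs : seq (nat * nat)) : nat :=
  (\sum_(b <- bs) b.1 ^ 2 * b.2)%N.
Definition mult_moment (bs : seq (nat * nat)) : nat :=
  (\sum_(b <- bs) b.1 * b.2 ^ 2)%N.

Lemma perm_mblocksM (a b : monom) :
  (forall v, v \in finsupp a -> v \in finsupp b -> False) ->
  perm_eq (mblocks (mmul a b)) (mblocks a ++ mblocks b).
Proof.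
move=> dis; rewrite /mblocks.
have -> : [seq (pval v.1, a v) | v <- finsupp a] =
    [seq (pval v.1, mmul a b v) | v <- finsupp a].
  apply/eq_in_map => v va; rewrite cmM (fsfun_dflt (f := b)) ?addn0 //.
  by apply/negP => vb; exact: dis va vb.
have -> : [seq (pval v.1, b v) | v <- finsupp b] =
    [seq (pval v.1, mmul a b v) | v <- finsupp b].
  apply/eq_in_map => v vb; rewrite cmM (fsfun_dflt (f := a)) ?add0n //.
  by apply/negP => va; exact: dis va vb.
rewrite -map_cat; apply: perm_map; apply: uniq_perm.
- exact: fset_uniq.
- rewrite cat_uniq !fset_uniq andbT /=; apply/hasPn => v vb.
  by apply/negP => va; exact: dis va vb.
- by move=> v; rewrite mem_cat mdomD in_fsetU.
Qed.

Lemma deg_momentM a b : deg_moment (mblocks (mmul a b)) =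
  (deg_moment (mblocks a) + deg_moment (mblocks b))%N.
Proof.
rewrite /deg_moment /mblocks !big_map mdomD.
rewrite (@finsupp_big_incl _ _ _ a (finsupp a `|` finsupp b)%fset
  (fun v k => v.1 ^ 2 * k)%N) ?fsubsetUl // => [|v]; last exact: muln0.
rewrite (@finsupp_big_incl _ _ _ b (finsupp a `|` finsupp b)%fset
  (fun v k => v.1 ^ 2 * k)%N) ?fsubsetUr // => [|v]; last exact: muln0.
by rewrite -big_split; apply: eq_bigr => v _; rewrite cmM mulnDr.
Qed.

Lemma mult_momentM a b :
  (mult_moment (mblocks a) + mult_moment (mblocks b)
     <= mult_moment (mblocks (mmul a b)))%N /\
  (mult_moment (mblocks (mmul a b)) =
     mult_moment (mblocks a) + mult_moment (mblocks b) ->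
   forall v, v \in finsupp a -> v \in finsupp b -> False)%N.
Proof.
have -> : (mult_moment (mblocks (mmul a b)) =
    mult_moment (mblocks a) + mult_moment (mblocks b) +
    \sum_(v <- (finsupp a `|` finsupp b)%fset) v.1 * (2 * (a v * b v)))%N.
  rewrite /mult_moment /mblocks !big_map mdomD.
  rewrite (@finsupp_big_incl _ _ _ a (finsupp a `|` finsupp b)%fset
    (fun v k => v.1 * k ^ 2)%N) ?fsubsetUl // => [|v]; last exact: muln0.
  rewrite (@finsupp_big_incl _ _ _ b (finsupp a `|` finsupp b)%fset
    (fun v k => v.1 * k ^ 2)%N) ?fsubsetUr // => [|v]; last exact: muln0.
  by rewrite -!big_split; apply: eq_bigr => v _; rewrite cmM /= sqrnD !mulnDr.
split; first exact: leq_addr.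
rewrite -[RHS]addn0 => /addnI s0 v va vb.
have vU : v \in (finsupp a `|` finsupp b)%fset by rewrite in_fsetU va.
move: s0; rewrite (big_fsetD1 v) //= => /eqP; rewrite addn_eq0 => /andP[+ _].
rewrite !muln_eq0 /= -[(pval v.1 == 0)%N]negbK -lt0n (valP v.1) /=.
by move: va vb; rewrite -!cmE_neq0 => /negPf -> /negPf ->.
Qed.

Lemma sum_sqr_le (xs : seq nat) : all (leq 1) xs ->
  (\sum_(x <- xs) x ^ 2 <= (\sum_(x <- xs) x) ^ 2)%N /\
  (\sum_(x <- xs) x ^ 2 = (\sum_(x <- xs) x) ^ 2 -> size xs <= 1)%N.
Proof.
elim: xs => [|x xs IH] /=; first by rewrite !big_nil.
case/andP => x0 /[dup] xs0 /IH[le1 _]; rewrite !big_cons sqrnD.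
split=> [|e]; first by lia.
have: (x * \sum_(y <- xs) y = 0)%N by lia.
move/eqP; rewrite muln_eq0 -[(x == 0)%N]negbK -lt0n x0 /=.
by case: xs xs0 {IH le1 e} => //= y ys /andP[y0 _]; rewrite big_cons; lia.
Qed.

Lemma mblocks_squarefree_exp (u : monom) r : (0 < r)%N -> squarefree u ->
  mblocks (expcmn u r) =
  [seq (d, r) | d <- [seq pval v.1 | v <- finsupp u]].
Proof.
move=> r0 /squarefreeP su; rewrite /mblocks -map_comp.
have -> : finsupp (expcmn u r) = finsupp u.
  by apply/fsetP => v; rewrite -!cmE_neq0 expcmnE muln_eq0 negb_or -lt0n r0.
apply/eq_in_map => v; rewrite -cmE_neq0 => uv /=; rewrite expcmnE.
by have := su v; case: (u v) uv => [|[]] // _ _; rewrite muln1.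
Qed.

Lemma pserM_coef_neq0 (f g : pser) m : (f * g) m != 0 ->
  exists p q, [/\ mmul p q = m, f p != 0 & g q != 0].
Proof.
apply: contra_neqP => /forallNP h; apply: fsbig1 => -[p q] /= pqm.
apply/eqP; rewrite mulf_eq0; apply: contra_notT (h p).
by rewrite negb_or => /andP[fp gq]; exists q.
Qed.

Lemma block_prod_coef_neq0 (bs : seq (nat * nat)) (m : monom) :
  all pos_block bs -> block_prod Eplus bs m != 0 ->
  [/\ (deg_moment (mblocks m) <= deg_moment bs)%N,
      (mult_moment bs <= mult_moment (mblocks m))%N
    & deg_moment (mblocks m) = deg_moment bs ->
      mult_moment bs = mult_moment (mblocks m) -> perm_eq (mblocks m) bs].
Proof.
elim: bs m => [|[d r] bs IH] m /=.
  rewrite /block_prod big_nil -[_ m]/((m == mone)%:R) pnatr_eq0 eqb0 negbK.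
  by move=> _ /eqP ->; rewrite /mblocks mdom1.
case/andP => /andP[/= d0 r0] pos; rewrite /block_prod big_cons.
case/pserM_coef_neq0 => p [q [pqm fp /(IH _ pos)[degq multq eqq]]].
have [u up] : exists u, expcmn u r = p.
  apply/not_existsP => nu; case/eqP: fp; apply: series_pow_eq0 => u e.
  exact: nu e.
move: fp; rewrite -up series_pow_expcmn // /Eplus pnatr_eq0 eqb0 negbK.
case/andP => su /eqP /= wu.
pose xs := [seq pval v.1 | v <- finsupp u].
have Dp : mblocks p = [seq (e, r) | e <- xs].
  by rewrite -up mblocks_squarefree_exp.
have sx : (\sum_(x <- xs) x = d)%N.
  rewrite -wu /wdeg big_map; apply: eq_big_seq => v; rewrite -cmE_neq0 => uv.
  move/squarefreeP: su => /(_ v).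
  by case: (u v) uv => [|[]] // _ _; rewrite muln1.
have xs0 : all (leq 1) xs by apply/allP => _ /mapP[v _ ->]; exact: valP v.1.
have [sq1 sq2] := sum_sqr_le xs0; rewrite sx in sq1 sq2.
have degp : deg_moment (mblocks p) = ((\sum_(x <- xs) x ^ 2) * r)%N.
  by rewrite Dp /deg_moment big_map big_distrl.
have multp : mult_moment (mblocks p) = (d * r ^ 2)%N.
  by rewrite Dp /mult_moment big_map -sx big_distrl.
have [mle meq] := mult_momentM p q.
have degE : deg_moment ((d, r) :: bs) = (d ^ 2 * r + deg_moment bs)%N.
  by rewrite /deg_moment big_cons.
have multE : mult_moment ((d, r) :: bs) = (d * r ^ 2 + mult_moment bs)%N.
  by rewrite /mult_moment big_cons.
have sqr : ((\sum_(x <- xs) x ^ 2) * r <= d ^ 2 * r)%N.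
  by rewrite leq_mul2r sq1 orbT.
rewrite degE multE -pqm deg_momentM degp; rewrite multp in mle meq.
split; [lia | lia | move=> eG eH].
have xs1 : (size xs <= 1)%N.
  by apply: sq2; apply/eqP; rewrite -(eqn_pmul2r r0); apply/eqP; lia.
have xsE : xs = [:: d].
  move: sx xs1; case: (xs) => [|x [|]] //; first by rewrite big_nil; lia.
  by rewrite big_seq1 => ->.
have dis := meq ltac:(lia).
apply: perm_trans (perm_mblocksM dis) _; rewrite Dp xsE /= perm_cons.
by apply: eqq; lia.
Qed.

Definition to_pnat (k : nat) : Defs.pnat := insubd (@PNat 1 isT) k.

Lemma to_pnatK k : (0 < k)%N -> pval (to_pnat k) = k.
Proof. by move=> k0; rewrite [LHS]val_insubd k0. Qed.

(* The second index, the number of remaining blocks, makes the variables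
   pairwise distinct. *)
Fixpoint block_monom (bs : seq (nat * nat)) : monom :=
  if bs is b :: bs' then
    mmul (xpow (to_pnat b.1, to_pnat (size bs)) b.2) (block_monom bs')
  else mone.

Lemma finsupp_block_monom bs v : v \in finsupp (block_monom bs) ->
  (pval v.2 <= size bs)%N.
Proof.
elim: bs => [|b bs IH] /=; first by rewrite mdom1.
rewrite mdomD in_fsetU => /orP[|/IH h]; last exact: leq_trans h (leqnSn _).
rewrite -cmE_neq0 xpowE.
by case: (_ =P v) => [<-|]; rewrite ?muln0 //= to_pnatK.
Qed.

Lemma perm_mblocks_monom bs : all pos_block bs ->
  perm_eq (mblocks (block_monom bs)) bs.
Proof.
elim: bs => [|[d r] bs IH] /=; first by rewrite /mblocks mdom1.
case/andP => /andP[/= d0 r0] /IH {}IH.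
apply: perm_trans (perm_mblocksM _) _.
  move=> v; rewrite finsupp_xpow // => /fset1P -> /finsupp_block_monom.
  by rewrite to_pnatK // ltnn.
rewrite {1}/mblocks finsupp_xpow //= enum_fsetE enum_fset1.
by rewrite /= xpowE eqxx muln1 to_pnatK // perm_cons.
Qed.

Definition nneg_pser (f : pser) := forall m, 0 <= f m.

Lemma nneg_pserM f g : nneg_pser f -> nneg_pser g -> nneg_pser (f * g).
Proof. by move=> f0 g0 m; apply: fsumr_ge0 => p _; exact: mulr_ge0. Qed.

Lemma pserM_coef_gt0 (f g : pser) a b : nneg_pser f -> nneg_pser g ->
  0 < f a -> 0 < g b -> 0 < (f * g) (mmul a b).
Proof.
move=> f0 g0 fa gb; rewrite pserME (seriesME_divs _ _ (divs_self _)).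
have ain : a \in divs (mmul a b) by apply/divsP; exists b.
have bin : b \in divs (mmul a b) by apply/divsP; exists a; rewrite mulmC.
rewrite (big_fsetD1 _ ain) /= (big_fsetD1 _ bin) /= eqxx mulr1 -addrA.
apply: ltr_wpDr; last exact: mulr_gt0.
by apply: addr_ge0; apply: sumr_ge0 => p _; rewrite ?sumr_ge0 // => *;
  rewrite !mulr_ge0.
Qed.

Lemma nneg_block_Eplus (b : nat * nat) :
  nneg_pser (series_pow b.2 (Eplus b.1)).
Proof. by move=> m; apply: fsumr_ge0 => u _; rewrite /Eplus ler0n. Qed.

Lemma nneg_block_prod bs : nneg_pser (block_prod Eplus bs).
Proof.
rewrite /block_prod; elim: bs => [|b bs IH].
  by move=> m; rewrite big_nil -[X in _ <= X]/((m == mone)%:R) ler0n.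
by rewrite big_cons; apply: nneg_pserM => //; exact: nneg_block_Eplus.
Qed.

Lemma block_prod_monom_gt0 bs : all pos_block bs ->
  0 < block_prod Eplus bs (block_monom bs).
Proof.
elim: bs => [|[d r] bs IH] /=.
  by rewrite /block_prod big_nil -[X in _ < X]/((mone == mone)%:R) eqxx.
case/andP => /andP[/= d0 r0] /IH {}IH.
rewrite /block_prod big_cons; apply: pserM_coef_gt0 => //.
- exact: nneg_block_Eplus.
- exact: nneg_block_prod.
rewrite /xpow series_pow_expcmn // /Eplus.
set v := (_, _); have := wdeg_xpow v 1; rewrite /xpow /= => wv.
have -> : squarefree (ucm v).
  by apply/squarefreeP => w; rewrite cmU; case: (v == w).
suff -> : wdeg (ucm v) = d by rewrite eqxx ltr0n.
by rewrite wv mul1n to_pnatK.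
Qed.

Lemma Eplus_indep n (c : typ n -> rat) :
  (forall m, \sum_(r <- fset_set [set: typ n]) c r * of_typ Eplus r m = 0) ->
  forall r, c r = 0.
Proof.
move=> c0; set U := fset_set _ in c0.
have inU r : r \in U by rewrite in_fset_set ?inE //; exact: finite_typ.
move=> r0; apply/eqP/negPn/negP => cr0.
pose mu (r : typ n) : int :=
  (deg_moment (blocks r))%:Z - (mult_moment (blocks r))%:Z.
pose P (x : U) := c (val x) != 0.
have P0 : P [` inU r0]%fset by [].
case: (Order.TotalTheory.arg_maxP (fun x : U => mu (val x)) P0).
move=> [t tU]; rewrite /P /= => ct tmax.
set m := block_monom (blocks t).
have tm : perm_eq (mblocks m) (blocks t) := perm_mblocks_monom (blocks_pos t).
have degE : deg_moment (mblocks m) = deg_moment (blocks t) := perm_big _ tm.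
have multE : mult_moment (mblocks m) = mult_moment (blocks t) := perm_big _ tm.
have := c0 m; rewrite (big_fsetD1 t) //= big1_fset ?addr0.
  move/eqP; rewrite mulf_eq0 (negPf ct) /=.
  by rewrite gt_eqF // of_typE block_prod_monom_gt0 // blocks_pos.
move=> r; rewrite in_fsetD1 => /andP[rt rU] _; apply/eqP; rewrite mulf_eq0.
apply: contra_neqT rt; rewrite negb_or => /andP[cr].
case/(block_prod_coef_neq0 (blocks_pos r)) => degr multr eqr.
have := tmax [` rU]%fset cr; rewrite /mu /= => mur.
apply: blocks_inj; rewrite perm_sym; apply: perm_trans _ (eqr _ _).
- by rewrite perm_sym.
- by rewrite degE; move: degr multr mur; rewrite degE multE; lia.
- by rewrite multE; move: degr multr mur; rewrite degE multE; lia.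
Qed.

(** * The expansion *)

Lemma content_pos n (s : typ n) T :
  T \in tabloids s -> all pos_block (content T).
Proof.
move=> /mem_tabloids[_ bT _ _]; apply/allP => _ /allpairsPdep[i [b [_ bin ->]]].
have p0 : (0 < 2 ^ b.1)%N by rewrite expn_gt0.
case/flattenP: bin => row rT brow; have [b0 kb] := bT _ _ _ rT brow.
by rewrite /pos_block /= divn_gt0 // dvdn_leq //= muln_gt0 p0 (valP i).
Qed.

Lemma sum_content n (s : typ n) T : T \in tabloids s ->
  (\sum_(b <- content T) b.1 * b.2 = n)%N.
Proof.
move=> Ts; have [sT bT _ _] := (mem_tabloids s T).1 Ts.
rewrite -[RHS](sum_blocks s) (sum_fsblocks s) -(finsupp_tabloid Ts).
rewrite /content big_allpairs_dep; apply: eq_bigr => i _ /=.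
rewrite big_flatten -sT sumnE big_map big_distrr.
apply: eq_big_seq => row rT /=.
rewrite sumnE big_map big_distrr; apply: eq_big_seq => b brow /=.
have [_ kb] := bT _ _ _ rT brow.
by rewrite mulnA divnK // mulnC.
Qed.

Definition tabloid_weight n (s : typ n) (T : bricking) : rat :=
  (-1) ^+ (size (content T) + tlength s) * (Lstar T)%:R.

Lemma size_blocks n (t : typ n) : size (blocks t) = tlength t.
Proof. by rewrite /blocks size_allpairs_dep sumnE big_map. Qed.

Lemma sum_PT_sing n (s t : typ n) :
  \sum_(T \in PT_sing s t)
     ((-1) ^ ((tlength t)%:Z - (tlength s)%:Z) * (Lstar T)%:R : rat) =
  \sum_(T <- tabloids s | perm_eq (content T) (blocks t)) tabloid_weight s T.
Proof.
rewrite PT_singE -fsbig_seq ?filter_uniq ?uniq_tabloids // big_filter.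
apply: eq_bigr => T /perm_size cT; rewrite /tabloid_weight cT size_blocks.
congr (_ * _).
by rewrite expfzDr ?oppr_eq0 ?oner_eq0 // -exprz_inv invrN1 -!exprnP -exprD.
Qed.

Lemma Ppoly_expansion n (s : typ n) m :
  of_typ Ppoly s m = \sum_(r <- fset_set [set: typ n])
    (\sum_(T <- tabloids s | perm_eq (content T) (blocks r)) tabloid_weight s T)
    * of_typ Eplus r m.
Proof.
rewrite of_typ_Ppoly pser_sumE.
under [RHS]eq_bigr do rewrite mulr_suml big_mkcond.
rewrite exchange_big; apply: eq_big_seq => T Ts /=.
have [t tT] := typ_of_blocks (content_pos Ts) (sum_content Ts).
have tU : t \in fset_set [set: typ n].
  by rewrite in_fset_set ?inE //; exact: finite_typ.
rewrite (big_fsetD1 t) //= tT [X in _ + X]big1_fset ?addr0.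
  rewrite pserMnE pser_signE of_typE /tabloid_weight mulrAC mulr_natr.
  by rewrite /block_prod (perm_big _ tT).
move=> r; rewrite in_fsetD1 => /andP[rt _] _; case: ifP => // rT.
case/eqP: rt; apply: blocks_inj; apply: perm_trans tT.
by rewrite perm_sym.
Qed.

Theorem theorem55 (n : nat) (s t : typ n) :
  exists2 c : typ n -> rat,
    unique (expands (fun r : typ n => of_typ Eplus r) (of_typ Ppoly s)) c
    & c t = \sum_(T \in PT_sing s t)
              ((-1) ^ ((tlength t)%:Z - (tlength s)%:Z) * (Lstar T)%:R : rat).
Proof.
exists (fun r => \sum_(T <- tabloids s | perm_eq (content T) (blocks r))
                   tabloid_weight s T); last by rewrite sum_PT_sing.
split=> [m|c' ex].
  by rewrite Ppoly_expansion fsbig_finite //; exact: finite_typ.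
apply/funext => r; apply/eqP; rewrite -subr_eq0; apply/eqP; move: r.
apply: Eplus_indep => m; under eq_bigr do rewrite mulrBl.
rewrite sumrB -Ppoly_expansion ex fsbig_finite ?subrr //; exact: finite_typ.
Qed.
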